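(* For $\nu\in\mathcal{E}$ (written in expanded indexing $\nu=(\nu_1,\ldots,\nu_{p+2s})$), the following are equivalent: (1) $\nu\in\Phi(\mathcal{O})$; (2) for every $i\in I$ with $\mathbf{Br}_\nu(i)>i$ we have $\nu^-(i)\gg\nu_{\mathbf{Br}_\nu(i)}+\frac{\mathbf{Br}_\nu(i)-i}{2}$ (vacuous if $\nu_i+\nu_{i+1}$ is the first part of $\nu$) and $\nu_{\mathbf{Br}_\nu(i)}+\frac{\mathbf{Br}_\nu(i)-i}{2}\not\succ\nu_i+\nu_{i+1}$; (3) for every $i\in\mathcal{TS}(\nu)$ with $\mathbf{Br}_\nu(i)>i$ we have $\nu_i+\nu_{i+1}\succ\nu_{\mathbf{Br}_\nu(i)}+\frac{\mathbf{Br}_\nu(i)-i}{2}$.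
   Context: Primary colors $a_1<\cdots<a_n$; secondary colors $a_ia_j$ ($i<j$); total order $a_1a_2<\cdots<a_1a_n<a_1<a_2a_3<\cdots<a_2a_n<a_2<\cdots<a_{n-1}a_n<a_{n-1}<a_n$. A part $k_p$ has integer size $k$ and color $p$; $k_p+m=(k+m)_p$. $k_p\succ l_q$ iff $k-l\ge\chi(p\le q)$; $\succeq$ means $\succ$ or equal. Special pairs: $(a_ka_l,a_ia_j)$ with $i<j<k<l$ or $k<i<j<l$. $\mathcal{P}$: primary-colored parts of positive size; $\mathcal{S}$: secondary-colored parts of size $\ge2$. $k_p\triangleright l_q$ iff $k_p\succeq(l+1)_q$ if $p$ or $q$ primary, $k_p\succ(l+1)_q$ if both secondary. $k_p\gg l_q$ iff $k_p\succeq(l+1)_q$ if $p$ or $q$ primary; $k_p\succ(l+1)_q$ if both secondary, not special; $k_p\succ l_q$ if special. $\mathcal{O}$: sequences $\lambda_1\succ\cdots\succ\lambda_t$ in $\mathcal{P}$; $\mathcal{E}$: sequences $\nu_1\gg\cdots\gg\nu_t$ in $\mathcal{P}\sqcup\mathcal{S}$. Halves: $\alpha((2k)_{a_ia_j})=k_{a_j}$, $\beta((2k)_{a_ia_j})=k_{a_i}$, $\alpha((2k+1)_{a_ia_j})=(k+1)_{a_i}$, $\beta((2k+1)_{a_ia_j})=k_{a_j}$. Machine $\Phi$ on $\lambda_1,\ldots,\lambda_t$: Step 1: take the smallest $i$ with $\lambda_i,\lambda_{i+1}\in\mathcal{P}$, $\lambda_i\succ\lambda_{i+1}$, not $\lambda_i\gg\lambda_{i+1}$;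 if it exists replace them by one part of size the sum of sizes and secondary color the product of their colors, go to Step 2; else stop. Step 2: take the smallest $i$ with $(\lambda_i,\lambda_{i+1})\in\mathcal{P}\times\mathcal{S}$ and not $\lambda_i\gg\lambda_{i+1}$; if it exists replace $(\lambda_i,\lambda_{i+1})$ by $(\lambda_{i+1}+1,\lambda_i-1)$ and redo Step 2; else go to Step 1. $\Phi(\mathcal{O})$ is the set of outputs. Expanded indexing: for $\nu\in\mathcal{E}$ with $p$ primary and $s$ secondary parts, write $\nu=(\nu_1,\ldots,\nu_{p+2s})$ replacing each secondary part in place by its upper half $\alpha$ followed by its lower half $\beta$; $J$ = indices of original primary parts, $I$ = indices of upper halves; $\nu_i+\nu_{i+1}$ ($i\in I$) denotes the original secondary part. $\nu^-(i)$ is the original part immediately left of $\nu_i+\nu_{i+1}$. Set $\nu_{p+2s+1}=0_{a_n}$. Bridge: for $i\in I$ let $j=\min((i,p+2s+1]\cap(J\cup\{p+2s+1\}))$. If $\nu_{i'+1}\not\succ\nu_j+\frac{j-i'}{2}-1$ for all $i'\in[i,j)\cap I$, then $\mathbf{Br}_\nu(i)=j$; otherwise with $\mathcal{S}_i=\{u\in(i,j)\cap I:\nu_{i'+1}\not\succ\nu_u+\frac{u-i'}{2}-1\ \forall i'\in[i,u)\cap I\}$, $\mathbf{Br}_\nu(i)=\max\mathcal{S}_i$ if $\mathcal{S}_i\neq\emptyset$ and $\mathbf{Br}_\nu(i)=i$ otherwise. $\mathcal{TS}(\nu)$: the set of $i\in I$ such that the part after $\nu_i+\nu_{i+1}$ is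 a secondary part $\nu_{i+2}+\nu_{i+3}$ with $\nu_i+\nu_{i+1}\not\triangleright\,\nu_{i+2}+\nu_{i+3}$, and $\nu^-(i)\triangleright\nu_i+\nu_{i+1}$ (this last condition regarded as satisfied when $\nu_i+\nu_{i+1}$ is the first part). *)

(* Defs.v *)
From HB Require Import structures.
From mathcomp Require Import all_boot all_order all_algebra.

Set Implicit Arguments.
Unset Strict Implicit.
Unset Printing Implicit Defensive.

Import Order.TTheory GRing.Theory Num.Theory.
Local Open Scope ring_scope.

(* There are n.+1 primary colors: a_1 < ... < a_(n+1) are the elements of
   'I_n.+1 shifted by one. The boundary value of the expanded indexing is
   colored by the largest of them, so there has to be at least one. *)
Inductive color (n : nat) : Type :=
  | Primary of 'I_n.+1
  | Secondary (i j : 'I_n.+1) of (i < j)%N.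
Arguments Primary {n} i.
Arguments Secondary {n} i j lt_ij.

Definition color_encode n (c : color n) : 'I_n.+1 * option 'I_n.+1 :=
  match c with
  | Primary i => (i, None)
  | Secondary i j _ => (i, Some j)
  end.

Lemma color_encode_inj n : injective (@color_encode n).
Proof.
move=> [i|i j lt_ij] [k|k l lt_kl] //= [].
- by move=> ->.
- move=> ik jl; move: lt_ij lt_kl; rewrite ik jl => h h'.
  by rewrite (eq_irrelevance h h').
Qed.

HB.instance Definition _ n := Equality.copy (color n) (inj_type (@color_encode_inj n)).

Definition is_primary n (c : color n) : bool :=
  if c is Primary _ then true else false.

(* The order
     a_1a_2 < ... < a_1a_n < a_1 < a_2a_3 < ... < a_2a_n < a_2 < ... < a_n
   is lexicographic, a_i being placed after all the a_ia_j. *)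
Definition le_color n (p q : color n) : bool :=
  match p, q with
  | Primary i, Primary k => (i <= k)%N
  | Primary i, Secondary k _ _ => (i < k)%N
  | Secondary i _ _, Primary k => (i <= k)%N
  | Secondary i j _, Secondary k l _ => (i < k)%N || (i == k) && (j <= l)%N
  end.

(* None unless p and q are distinct primary colors. *)
Definition mul_color n (p q : color n) : option (color n) :=
  match p, q with
  | Primary i, Primary j =>
      match @idP (i < j)%N, @idP (j < i)%N with
      | ReflectT lt_ij, _ => Some (Secondary i j lt_ij)
      | _, ReflectT lt_ji => Some (Secondary j i lt_ji)
      | _, _ => None
      end
  | _, _ => None
  end.

Definition special_pair n (p q : color n) : bool :=
  match p, q with
  | Secondary k l _, Secondary i j _ =>
      [&& i < j, j < k & k < l]%N || [&& k < i, i < j & j < l]%N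
  | _, _ => false
  end.

Record part (n : nat) := Part { psize : int; pcolor : color n }.
Arguments Part {n} psize pcolor.

Definition part_encode n (x : part n) := (psize x, pcolor x).

Lemma part_encode_inj n : injective (@part_encode n).
Proof. by move=> [k p] [l q] [-> ->]. Qed.

HB.instance Definition _ n := Equality.copy (part n) (inj_type (@part_encode_inj n)).

Definition primary_part n (x : part n) : bool := is_primary (pcolor x).
Definition secondary_part n (x : part n) : bool := ~~ is_primary (pcolor x).

(* k_p + m = (k + m)_p *)
Definition shift n (x : part n) (m : int) : part n :=
  Part (psize x + m) (pcolor x).

(* The relations on parts written, in the usual notation,
   x \succ y, x \succeq y, x \triangleright y and x \gg y. *)
Definition succ n (x y : part n) : bool :=
  (le_color (pcolor x) (pcolor y) : nat)%:Z <= psize x - psize y.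

Definition succeq n (x y : part n) : bool := succ x y || (x == y).

Definition tri n (x y : part n) : bool :=
  if primary_part x || primary_part y then succeq x (shift y 1)
  else succ x (shift y 1).

Definition gg n (x y : part n) : bool :=
  if primary_part x || primary_part y then succeq x (shift y 1)
  else if special_pair (pcolor x) (pcolor y) then succ x y
  else succ x (shift y 1).

Definition mem_P n (x : part n) : bool := primary_part x && (0 < psize x).
Definition mem_S n (x : part n) : bool := secondary_part x && (2 <= psize x).

Definition mem_O n (s : seq (part n)) : bool :=
  all (@mem_P n) s && sorted (@succ n) s.
Definition mem_E n (s : seq (part n)) : bool :=
  all (fun x => mem_P x || mem_S x) s && sorted (@gg n) s.

(* The upper and lower halves; the value at a primary part is irrelevant. *)
Definition upper_half n (x : part n) : part n :=
  match pcolor x with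
  | Primary _ => x
  | Secondary i j _ =>
      if (2 %| psize x)%Z then Part (psize x %/ 2)%Z (Primary j)
      else Part ((psize x %/ 2)%Z + 1) (Primary i)
  end.

Definition lower_half n (x : part n) : part n :=
  match pcolor x with
  | Primary _ => x
  | Secondary i j _ =>
      if (2 %| psize x)%Z then Part (psize x %/ 2)%Z (Primary i)
      else Part (psize x %/ 2)%Z (Primary j)
  end.

(* One application of Step 1, None when no pair is troublesome.
   A troublesome pair has distinct primary colors (k_p \succ l_p implies
   k_p \gg l_p), so the omap never hides a None coming from mul_color. *)
Fixpoint step1 n (s : seq (part n)) : option (seq (part n)) :=
  if s is x :: ((y :: s') as r) then
    if [&& mem_P x, mem_P y, succ x y & ~~ gg x y] then
      omap (fun c => Part (psize x + psize y) c :: s')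
           (mul_color (pcolor x) (pcolor y))
    else omap (cons x) (step1 r)
  else None.

Fixpoint step2 n (s : seq (part n)) : option (seq (part n)) :=
  if s is x :: ((y :: s') as r) then
    if [&& mem_P x, mem_S y & ~~ gg x y] then
      Some (shift y 1 :: shift x (-1) :: s')
    else omap (cons x) (step2 r)
  else None.

(* Big-step semantics of the machine: at_step1 s t (resp. at_step2 s t) means
   that, started at Step 1 (resp. Step 2) on s, it stops with output t. *)
Inductive at_step1 n : seq (part n) -> seq (part n) -> Prop :=
  | Step1_stop s : step1 s = None -> at_step1 s s
  | Step1_merge s s' t : step1 s = Some s' -> at_step2 s' t -> at_step1 s t
with at_step2 n : seq (part n) -> seq (part n) -> Prop :=
  | Step2_cross s s' t : step2 s = Some s' -> at_step2 s' t -> at_step2 s t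
  | Step2_done s t : step2 s = None -> at_step1 s t -> at_step2 s t.

Definition Phi_output n (lambda nu : seq (part n)) : Prop :=
  at_step1 lambda nu.

Definition mem_Phi_O n (nu : seq (part n)) : Prop :=
  exists2 lambda : seq (part n), mem_O lambda & Phi_output lambda nu.

(* Expanded indexing. Positions are numbered from 0, so that position i here
   is the index i + 1 of the 1-based convention, and the final boundary
   p + 2s + 1 is the position xlen nu. *)
Inductive slot := Jslot | Upper | Lower.

Definition slots n (nu : seq (part n)) : seq slot :=
  flatten [seq if secondary_part x then [:: Upper; Lower] else [:: Jslot] | x <- nu].

Definition xlen n (nu : seq (part n)) : nat := size (slots nu).

Definition mem_I n (nu : seq (part n)) (i : nat) : bool :=
  if nth Lower (slots nu) i is Upper then true else false.
Definition mem_J n (nu : seq (part n)) (i : nat) : bool :=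
  if nth Lower (slots nu) i is Jslot then true else false.

(* The default of nth gives the boundary value 0_{a_n} at position xlen nu. *)
Definition xpart n (nu : seq (part n)) (i : nat) : part n :=
  nth (Part 0 (Primary ord_max))
      (flatten [seq if secondary_part x then [:: upper_half x; lower_half x]
                    else [:: x] | x <- nu]) i.

(* The original part of nu covering position i: for i in I it is the
   secondary part nu_i + nu_(i+1). *)
Definition orig n (nu : seq (part n)) (i : nat) : part n :=
  nth (Part 0 (Primary ord_max))
      (flatten [seq if secondary_part x then [:: x; x] else [:: x] | x <- nu]) i.

(* nu^-(i); None when the part covering position i is the first one. *)
Definition left_part n (nu : seq (part n)) (i : nat) : option (part n) :=
  if i is i'.+1 then Some (orig nu i') else None.

(* nu_(i'+1) \not\succ nu_u + (u - i')/2 - 1 for all i' in [i, u) /\ I. Only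
   used when positions i, ..., u - 1 are all halves of secondary parts, and
   then u - i' is even. *)
Definition bridgeable n (nu : seq (part n)) (i u : nat) : bool :=
  all (fun i' => ~~ succ (xpart nu i'.+1)
                         (shift (xpart nu u) ((u - i')./2%:Z - 1)))
      [seq i' <- index_iota i u | mem_I nu i'].

Definition next_primary n (nu : seq (part n)) (i : nat) : nat :=
  \big[minn/xlen nu]_(i.+1 <= j < xlen nu | mem_J nu j) j.

(* All u in the range of the maximum exceed i, so the initial value i is the
   result only if there is no such u. *)
Definition Br n (nu : seq (part n)) (i : nat) : nat :=
  let j := next_primary nu i in
  if bridgeable nu i j then j
  else \big[maxn/i]_(i.+1 <= u < j | mem_I nu u && bridgeable nu i u) u.

(* nu_(Br(i)) + (Br(i) - i)/2 *)
Definition bridge_part n (nu : seq (part n)) (i : nat) : part n :=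
  shift (xpart nu (Br nu i)) ((Br nu i - i)./2%:Z).

Definition TS n (nu : seq (part n)) (i : nat) : Prop :=
  [/\ mem_I nu i,
      mem_I nu i.+2,
      ~~ tri (orig nu i) (orig nu i.+2)
    & forall x, left_part nu i = Some x -> tri x (orig nu i)].

(* Main.v *)
Require Import Defs.
From mathcomp Require Import all_boot all_order all_algebra.
From mathcomp Require Import zify.

(* All parts are totally ordered lexicographically, and a secondary part is a
   pair of primary parts, its halves, at distance less than one. Let the machine
   run backwards on nu: starting with the last secondary part x, move x to the
   right through primary parts w, each time replacing (x, w) by (w + 1, x - 1),
   until the lower half of x exceeds the next part; then split x. The first
   primary part obtained from x and what follows it is the bridge part
   nu_Br + (Br - i)/2 if x moves at all, i.e. if Br(i) > i, and the upper half
   of x otherwise.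

   Running forwards, neither a merging nor a crossing changes the first primary
   part recovered from any suffix, so condition (2) is an invariant of the
   machine. Conversely (2) says precisely that each backward move is undone by
   a forward one.

   Condition (3) gives the inequality x > bridge part when x is in TS(nu). If x
   is related by tri to both neighbours, it follows from the same inequality for
   the next part, and if x is not related by tri to its left neighbour, from the
   inequality for that neighbour. *)

Set Implicit Arguments.
Unset Strict Implicit.
Unset Printing Implicit Defensive.

Import Order.TTheory GRing.Theory Num.Theory.
Local Open Scope ring_scope.

(** * The order on parts *)

(** Two digits in base [n.+2]. A primary color takes [n.+1] as second digit, larger than every
    index, and so follows all secondary colors with the same first index. *)
Definition color_rank n (c : color n) : nat :=
  match c with
  | Primary i => (i * n.+2 + n.+1)%N
  | Secondary i j _ => (i * n.+2 + j)%N
  end.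

Definition key_base n : int := (n.+1 * n.+2)%:Z.

(* As [key_base] exceeds all color ranks, keys compare lexicographically, and
   a shift by one adds [key_base]. *)
Definition key n (x : part n) : int :=
  psize x * key_base n + (color_rank (pcolor x))%:Z.

Lemma leq_lex n (a b c d : nat) : (b < n)%N -> (d < n)%N ->
  (a * n + b <= c * n + d)%N = (a < c)%N || (a == c) && (b <= d)%N.
Proof. move=> ? ?; nia. Qed.

Lemma le_colorE n (p q : color n) :
  le_color p q = (color_rank p <= color_rank q)%N.
Proof.
case: p q => [[i ip]|[i ip] [j jp] ij] [[k kp]|[k kp] [l lp] kl] /=;
  rewrite leq_lex ?eqE /=; lia.
Qed.

Lemma color_rank_lt n (p : color n) : (color_rank p < n.+1 * n.+2)%N.
Proof. by case: p => [[i ip]|[i ip] [j jp] ij] /=; nia. Qed.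

Lemma color_rank_inj n : injective (@color_rank n).
Proof.
move=> p q e.
have: le_color p q && le_color q p by rewrite !le_colorE e leqnn.
case: p q {e} => [i|i j ij] [k|k l kl] /=; try lia.
  by rewrite -eqn_leq => /eqP/val_inj ->.
move=> h; have [/val_inj ik /val_inj jl] : i = k :> nat /\ j = l :> nat.
  by move: h; rewrite !eqE /=; lia.
by subst; rewrite (eq_irrelevance ij kl).
Qed.

Lemma key_base_gt0 n : 0 < key_base n.
Proof. rewrite /key_base; lia. Qed.

Lemma key_shift n (x : part n) m : key (shift x m) = key x + m * key_base n.
Proof. by rewrite /key /= mulrDl addrAC. Qed.

Lemma succE n (x y : part n) : succ x y = (key y < key x).
Proof.
rewrite /succ /key le_colorE.
have := color_rank_lt (pcolor x); have := color_rank_lt (pcolor y).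
rewrite /key_base.
move: (color_rank _) (color_rank _) (_ * _)%N (psize x) (psize y) => a b M k l.
case: leqP => /=; nia.
Qed.

Lemma key_inj n : injective (@key n).
Proof.
move=> [k p] [l q] e.
have p_lt := color_rank_lt p; have q_lt := color_rank_lt q.
have kl : k = l by move: e; rewrite /key /key_base /=; nia.
by move: e; rewrite /key /= kl => /addrI [/color_rank_inj ->].
Qed.

Lemma succeqE n (x y : part n) : succeq x y = (key y <= key x).
Proof.
rewrite /succeq succE le_eqVlt orbC eq_sym; congr (_ || _).
by apply/eqP/eqP => [->|/key_inj].
Qed.

Lemma triE n (x y : part n) :
  tri x y = if primary_part x || primary_part y
            then key y + key_base n <= key x
            else key y + key_base n < key x.
Proof. by rewrite /tri succeqE succE key_shift mul1r. Qed.

Lemma gg_primary n (x y : part n) : primary_part x || primary_part y ->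
  gg x y = (key y + key_base n <= key x).
Proof. by rewrite /gg => ->; rewrite succeqE key_shift mul1r. Qed.

(** Makes weak comparisons between a primary and a secondary part strict. *)
Lemma key_neq n (x y : part n) : primary_part x != primary_part y ->
  key x != key y.
Proof. by apply: contra_neq => /key_inj ->. Qed.

Lemma primary_shift n (x : part n) m : primary_part (shift x m) = primary_part x.
Proof. by []. Qed.

Lemma secondaryN n (x : part n) : secondary_part x = ~~ primary_part x.
Proof. by []. Qed.

Lemma shiftD n (x : part n) a b : shift (shift x a) b = shift x (a + b).
Proof. by rewrite /shift /= addrA. Qed.

Lemma shift0 n (x : part n) : shift x 0 = x.
Proof. by case: x => k p; rewrite /shift addr0. Qed.

(** * Halves of secondary parts *)

Variant halves_spec n : part n -> part n -> part n -> Prop :=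
  | HalvesEven (q : int) (i j : 'I_n.+1) (ij : (i < j)%N) :
      halves_spec (Part (q * 2) (Secondary i j ij))
                  (Part q (Primary j)) (Part q (Primary i))
  | HalvesOdd (q : int) (i j : 'I_n.+1) (ij : (i < j)%N) :
      halves_spec (Part (q * 2 + 1) (Secondary i j ij))
                  (Part (q + 1) (Primary i)) (Part q (Primary j)).

(** Writing the size as [q * 2] or [q * 2 + 1] removes the divisions, so that comparisons with the
    halves become linear arithmetic. *)
Lemma halvesP n (x : part n) : secondary_part x ->
  halves_spec x (upper_half x) (lower_half x).
Proof.
case: x => k [//|i j ij] _.
have e := divz_eq k 2; have : 0 <= (k %% 2)%Z < 2 by lia.
rewrite /upper_half /lower_half /=.
case: ifP => k2 k01.
  have k0 : (k %% 2)%Z = 0 by lia.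
  by rewrite {1}e k0 addr0; constructor.
have k1 : (k %% 2)%Z = 1 by lia.
by rewrite {1}e k1; constructor.
Qed.

Lemma upper_half_primary n (x : part n) : secondary_part x ->
  primary_part (upper_half x).
Proof. by case/halvesP. Qed.

Lemma lower_half_primary n (x : part n) : secondary_part x ->
  primary_part (lower_half x).
Proof. by case/halvesP. Qed.

Lemma primaryP n (x : part n) : primary_part x ->
  exists k i, x = Part k (Primary i).
Proof. by case: x => k [i|//] _; exists k, i. Qed.

Lemma mem_PS_secondary n (x : part n) :
  mem_P x || mem_S x -> secondary_part x -> mem_S x.
Proof.
by case/orP=> // /andP[px _]; rewrite secondaryN px.
Qed.

Lemma key_shift_neq n (x y : part n) m :
  primary_part x -> secondary_part y -> key (shift x m) != key y.
Proof.
move=> px; rewrite secondaryN => /negPf py.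
by apply: key_neq; rewrite primary_shift px py.
Qed.

Lemma tri_secondary n (x y : part n) : secondary_part x -> secondary_part y ->
  tri x y = (key y + key_base n < key x).
Proof. by rewrite triE !secondaryN => /negPf -> /negPf ->. Qed.

(** A shift by one changes the parity of the size, hence exchanges the roles of the two halves. *)
Lemma upper_halfS n (x : part n) : secondary_part x ->
  upper_half (shift x 1) = shift (lower_half x) 1.
Proof.
case: x => k [//|i j ij] _; rewrite /upper_half /lower_half /shift /=.
by case: ifP; case: ifP => ? ? /=; try lia; congr Part; lia.
Qed.

Lemma lower_halfS n (x : part n) : secondary_part x ->
  lower_half (shift x 1) = upper_half x.
Proof.
case: x => k [//|i j ij] _; rewrite /upper_half /lower_half /shift /=.
by case: ifP; case: ifP => ? ? /=; try lia; congr Part; lia.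
Qed.

Lemma halves_lt n (x : part n) : secondary_part x ->
  key (lower_half x) < key (upper_half x) < key (lower_half x) + key_base n.
Proof.
move=> sx; rewrite -[key_base n]mul1r -key_shift -!succE.
by case: (halvesP sx) => q [i ip] [j jp]; rewrite /succ /=; lia.
Qed.

Lemma upper_half_lt n (x : part n) : mem_S x -> key (upper_half x) < key x.
Proof.
rewrite -succE; case/andP=> sx.
case: (halvesP sx) => q [i ip] [j jp]; rewrite /succ /=; lia.
Qed.

Lemma key_leNsucc n (x y : part n) : (key x <= key y) = ~~ succ x y.
Proof. by rewrite succE leNgt. Qed.

Lemma gg_secondary n (x y : part n) : secondary_part x -> secondary_part y ->
  gg x y = if special_pair (pcolor x) (pcolor y) then succ x y
           else succ x (shift y 1).
Proof.
by rewrite /secondary_part /gg /primary_part; do 2!case: is_primary.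
Qed.

(** The upper half has only about half the size of [y], so for two secondary parts the inequality is
    tight only when [y] has size 2 or 3. If [x] has the same size, the pair is special, and both
    colors in [x] are above those in [y]. *)
Lemma gg_upper_half n (x y : part n) : mem_P x || mem_S x -> mem_S y -> gg x y ->
  key (upper_half y) + key_base n <= key x.
Proof.
move=> xPS yS; case px: (primary_part x).
  rewrite gg_primary ?px //; have := upper_half_lt yS; lia.
have := xPS; rewrite /mem_P px /= => xS; move: yS.
rewrite -[key_base n]mul1r -key_shift key_leNsucc.
case/andP: xS => sx x2; case/andP=> sy y2.
rewrite gg_secondary //.
case: x sx x2 {xPS px} => k [//|a b ab] _ x2.
move: y2; case: (halvesP sy) => q [i ip] [j jp]; rewrite /succ /=.
all: case: a b ab x2 => [a ap] [b bp] /= ab x2 ij y2.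
all: case: ifP => /=; lia.
Qed.

(** Propagates crossings to the left: where [tri] fails between [x] and [y], a part that [y] can
    pass gives, after a shift by one, a part that [x] can pass. *)
Lemma lower_half_le_shift n (x y : part n) : secondary_part x -> secondary_part y ->
  key x <= key y + key_base n ->
  key (lower_half x) <= key (lower_half y) + key_base n.
Proof.
move=> sx sy; rewrite -[key_base n]mul1r -!key_shift !key_leNsucc.
case: (halvesP sx) => q [i ip] [j jp] /= ij.
all: case: (halvesP sy) => r [k kp] [l lp] /= kl; rewrite /succ /=; lia.
Qed.

(* This is where the exact definition of special pairs matters: it keeps a
   secondary part moving back to the right from passing both halves of the
   next one. *)
Lemma gg_not_interleaved n (x y : part n) : secondary_part x -> secondary_part y ->
  gg x y -> key (lower_half x) <= key (upper_half y) ->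
  ~~ (key (upper_half x) <= key (lower_half y) + key_base n).
Proof.
move=> sx sy; rewrite -[key_base n]mul1r -!key_shift !key_leNsucc.
rewrite gg_secondary //.
case: (halvesP sx) => q [i ip] [j jp] /= ij.
all: case: (halvesP sy) => r [k kp] [l lp] /= kl; rewrite /succ /= !eqE /=;
  (case: ifP => sp; [move: sp|]); lia.
Qed.

(** Only size 2 could fail. Then [w] would have size 1, and the two inequalities would put its color
    both below and not below the smaller color of [x]. *)
Lemma mem_S_uncross n (x w : part n) : secondary_part x -> mem_P w ->
  key w + key_base n < key x -> key (lower_half x) <= key w ->
  mem_S (shift x (-1)).
Proof.
move=> sx; case/andP=> /primaryP[k [c ->]] /= k0.
rewrite -[key_base n]mul1r -!key_shift -succE key_leNsucc /mem_S [secondary_part _]sx /=.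
case: (halvesP sx) => q [i ip] [j jp] /= ij; case: c => [c cp];
  rewrite /succ /=; lia.
Qed.

Lemma mul_color_halves n (x : part n) : secondary_part x ->
  mul_color (pcolor (upper_half x)) (pcolor (lower_half x)) = Some (pcolor x) /\
  psize (upper_half x) + psize (lower_half x) = psize x.
Proof.
move=> sx; case: (halvesP sx) => q i j ij /=; (split; last by lia).
all: case: {-}_ / (@idP (j < i)%N) => // ?; try lia.
all: case: {-}_ / (@idP (i < j)%N) => // ?; try lia.
all: by congr (Some (Secondary _ _ _)); apply: eq_irrelevance.
Qed.

Lemma merge_halves n (y z : part n) : mem_P y -> mem_P z -> succ y z -> ~~ gg y z ->
  exists x, [/\ mem_S x, upper_half x = y, lower_half x = z &
    omap (fun c => Part (psize y + psize z) c) (mul_color (pcolor y) (pcolor z))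
    = Some x].
Proof.
move=> /andP[/primaryP[k [i ->]] k0] /andP[/primaryP[l [j ->]] l0].
rewrite gg_primary // -[key_base n]mul1r -key_shift key_leNsucc /succ /= => kl kl1.
have [x [sx [xu [xl x2]]]] : exists x : part n, secondary_part x /\
    upper_half x = Part k (Primary i) /\ lower_half x = Part l (Primary j)
    /\ 2 <= psize x.
  (* Being related by [succ] but not by [gg] leaves two cases: increasing colors with sizes
     differing by one, which give an odd sum, or decreasing colors with equal sizes, which give an
     even sum. *)
  have [ij|ji] : (i < j)%N /\ k = l + 1 \/ (j < i)%N /\ k = l by lia.
    case: ij => ij ->; exists (Part (l * 2 + 1) (Secondary i j ij)).
    rewrite /upper_half /lower_half /=; case: ifP; first lia.
    by move=> _; do !split; try (congr Part; lia); move: l0 => /=; lia.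
  case: ji => ji ->; exists (Part (l * 2) (Secondary j i ji)).
  rewrite /upper_half /lower_half /=; case: ifP; last lia.
  by move=> _; do !split; try (congr Part; lia); move: l0 => /=; lia.
exists x; split=> //; first by rewrite /mem_S sx.
have [] := mul_color_halves sx; rewrite xu xl /= => -> ->.
by case: x {sx xu xl x2}.
Qed.

(** * Leading primary parts *)

(* [lia] splits on every boolean in the context; keep the comparisons only. *)
Ltac key_lia :=
  repeat match goal with
  | H : ?T |- _ =>
    lazymatch T with
    | is_true (Order.le _ _) => fail
    | is_true (Order.lt _ _) => fail
    | is_true (~~ Order.le _ _) => fail
    | is_true (Order.lt _ _ && Order.lt _ _) => fail
    | is_true (_ != _) => fail
    | Order.le _ _ = false => fail
    | _ => clear H
    end
  end; lia.

Definition boundary n : part n := Part 0 (Primary ord_max).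

(** The boundary has size 0 and the largest color, so exceeding it means having positive size;
    positivity becomes one more comparison of keys. *)
Lemma mem_P_key n (x : part n) :
  mem_P x = primary_part x && (key (boundary n) < key x).
Proof.
rewrite /mem_P; case px: (primary_part x) => //=.
case: x px => k [[i ip]|//] _; rewrite -succE /succ /=; lia.
Qed.

Lemma lower_half_gt_boundary n (x : part n) : mem_S x ->
  key (boundary n) < key (lower_half x).
Proof.
rewrite -succE; case/andP=> sx.
by case: (halvesP sx) => q [i ip] [j jp] /=; rewrite /succ /=; lia.
Qed.

Lemma gg_next_primary n (x w : part n) : mem_S x -> mem_P w ->
  key w < key (lower_half x) -> gg x w.
Proof.
case/andP=> sx x2; case/andP=> pw w0; rewrite gg_primary ?pw ?orbT //.
case/primaryP: pw w0 => k [[c cp] ->] /=; move: x2.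
rewrite -[key_base n]mul1r -!key_shift key_leNsucc -succE.
by case: (halvesP sx) => q [i ip] [j jp] /=; rewrite /succ /=; lia.
Qed.

(* The first of the primary parts obtained from [s] by undoing the machine; at
   a secondary part it is the upper half or the bridge part. *)
Fixpoint lead n (s : seq (part n)) : part n :=
  if s is x :: s' then
    if secondary_part x && (key (lower_half x) <= key (lead s'))
    then shift (lead s') 1 else upper_half x
  else boundary n.

Lemma lead_primary n (s : seq (part n)) : primary_part (lead s).
Proof.
elim: s => //= x s IH; case: ifP => //.
case sx: (secondary_part x) => _; first exact: upper_half_primary.
by move: sx; case: x => k [].
Qed.

Lemma upper_half_id n (x : part n) : primary_part x -> upper_half x = x.
Proof. by case: x => k []. Qed.

Lemma lead_primary_cons n (x : part n) s : primary_part x -> lead (x :: s) = x.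
Proof. by move=> px /=; rewrite secondaryN px upper_half_id. Qed.

Lemma lead_ge_upper n (x : part n) s : secondary_part x ->
  key (upper_half x) <= key (lead (x :: s)).
Proof.
move=> sx /=; rewrite sx /=; case: ifP => // h; rewrite key_shift.
have := halves_lt sx; lia.
Qed.

Lemma lead_gt_tail n (x : part n) s : secondary_part x ->
  key (lead s) < key (lead (x :: s)).
Proof.
move=> sx /=; rewrite sx /=; have := key_base_gt0 n; have := halves_lt sx.
by case: ifP => // h; rewrite ?key_shift; lia.
Qed.

(** * Conditions (2) and (3) in terms of leading parts *)

Definition crosses n (x w : part n) : bool :=
  secondary_part x && (key (lower_half x) <= key w).

(* Condition (2) of the theorem at a secondary part [x] of left neighbour [t]
   followed by [s], where the bridge part is [shift (lead s) 1]. *)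
Definition bridge_ok n (t : option (part n)) (x : part n) (s : seq (part n)) :=
  crosses x (lead s) ==>
  (key (lead s) + key_base n < key x) &&
  (if t is Some y then key (lead s) + key_base n *+ 2 <= key y else true).

Fixpoint bridged n (t : option (part n)) (s : seq (part n)) : bool :=
  if s is x :: s' then bridge_ok t x s' && bridged (Some x) s' else true.

Lemma bridged_cat n t (s1 s2 : seq (part n)) :
  bridged t (s1 ++ s2) -> bridged (last t (map Some s1)) s2.
Proof. by elim: s1 t => //= x s1 IH t /andP[_ /IH]. Qed.

Lemma lead_cat n (s1 s2 s3 : seq (part n)) :
  lead s2 = lead s3 -> lead (s1 ++ s2) = lead (s1 ++ s3).
Proof. by move=> e; elim: s1 => //= x s1 ->. Qed.

(** The condition at a part depends on what follows it only through [lead], so replacing a suffix by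
    one with the same [lead] affects no condition to its left. *)
Lemma bridged_replace n t (s1 s2 s3 : seq (part n)) : lead s2 = lead s3 ->
  bridged t (s1 ++ s2) -> bridged (last t (map Some s1)) s3 ->
  bridged t (s1 ++ s3).
Proof.
move=> e; elim: s1 t => //= x s1 IH t /andP[h1 /IH h2 /h2 ->].
by rewrite andbT; move: h1; rewrite /bridge_ok (lead_cat s1 e).
Qed.

(* The same for condition (3). *)
Definition ts_ok n (t : option (part n)) (x : part n) (s : seq (part n)) : bool :=
  [&& secondary_part x,
      (if s is y :: _ then secondary_part y && ~~ tri x y else false)
    & (if t is Some y then tri y x else true)] ==>
  crosses x (lead s) ==> (key (lead s) + key_base n < key x).

Fixpoint ts_bridged n (t : option (part n)) (s : seq (part n)) : bool :=
  if s is x :: s' then ts_ok t x s' && ts_bridged (Some x) s' else true.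

(** Extends condition (3) to parts where [tri] holds on the right. There [lead s] is at most the
    next part: it is that part itself, its upper half, or its bridge part, bounded by induction. The
    relation [tri] supplies the extra [key_base]. *)
Lemma tri_lead n (t : option (part n)) s :
  all (fun x => mem_P x || mem_S x) s -> sorted (@gg n) s -> ts_bridged t s ->
  if s is x :: s' then
   (if t is Some y then tri y x else true) ==> crosses x (lead s') ==>
     (key (lead s') + key_base n < key x) else true.
Proof.
elim: s t => [//|x s IH] t /= /andP[xPS sPS] xs /andP[ok ts].
apply/implyP => tx; apply/implyP => xl.
have sx : secondary_part x by case/andP: xl.
move: ok; rewrite /ts_ok sx tx xl /=.
case: s IH sPS xs ts xl => [_ _ _ _|y s IH sPS /= /andP[xy ys] ts xl].
  (* With nothing to the right, [lead] is the boundary, which is below every lower half, so there is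
     no crossing. *)
  case/orP: xPS; rewrite /mem_P secondaryN in sx *; first by rewrite (negPf sx).
  by move=> /lower_half_gt_boundary; rewrite /crosses /= => h /andP[_]; key_lia.
have IHy := IH (Some x) sPS ys ts.
case: (boolP (secondary_part y)) => sy /=; last first.
  move=> _; have py : primary_part y by rewrite secondaryN negbK in sy.
  rewrite upper_half_id //=.
  have := xy; rewrite gg_primary ?py ?orbT //.
  by have := key_shift_neq 1 py sx; rewrite key_shift; key_lia.
case: (boolP (tri x y)) => //= xty _.
rewrite xty /crosses sy /= in IHy.
rewrite tri_secondary // in xty.
move: IHy; case: ifP => h /=; first by move=> ?; rewrite key_shift; key_lia.
case/andP: sPS => yPS _ _.
by have := upper_half_lt (mem_PS_secondary yPS sy); key_lia.
Qed.

Lemma gg_tri n (x y : part n) : gg x y ->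
  primary_part x || primary_part y -> tri x y.
Proof. by move=> + p; rewrite gg_primary // triE p. Qed.

(** Proceeds from left to right, carrying the inequality at the left neighbour [t]. If [tri] holds
    there, [tri_lead] applies. Otherwise the neighbour crosses too, its bridge part is that of [x]
    shifted by one, and its inequality yields both halves of condition (2) at [x]. *)
Lemma ts_bridged_bridged n (t : option (part n)) s :
  all (fun x => mem_P x || mem_S x) s -> sorted (@gg n) (seq_of_opt t ++ s) ->
  ts_bridged t s ->
  (if t is Some y then crosses y (lead s) ==> (key (lead s) + key_base n < key y)
   else true) ->
  bridged t s.
Proof.
elim: s t => // x s IH t sPS xs ts ty.
have xs' : sorted (@gg n) (x :: s) by case: t xs {ts ty} => //= y /andP[].
have := tri_lead sPS xs' ts.
move: sPS ts => /= /andP[xPS sPS] /andP[_ ts] lead_lt.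
have B0 := key_base_gt0 n.
have ok : bridge_ok t x s.
  apply/implyP => xl; have sx : secondary_part x by case/andP: xl.
  move: lead_lt; rewrite xl /=.
  case: t xs ty {IH} => [y|_ _ /= -> //] /= /andP[yx _] ty.
  case: (boolP (tri y x)) => /= [yx' lt | Nyx _].
    by move: yx'; rewrite lt triE; case: ifP => _; key_lia.
  (* The relation [gg] implies [tri] unless both parts are secondary. *)
  have /norP[] := contra (gg_tri yx) Nyx; rewrite -!secondaryN => sy _.
  have yx_le : key y <= key x + key_base n.
    by move: Nyx; rewrite tri_secondary //; key_lia.
  have := lower_half_le_shift sy sx yx_le.
  move: ty xl; rewrite /crosses sx sy /= => /implyP ty xl.
  rewrite xl key_shift in ty; move=> h; have := ty ltac:(key_lia); key_lia.
rewrite ok; apply: IH => //.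
by apply/implyP => xl; move/implyP: ok => /(_ xl) /andP[].
Qed.

(** Condition (2) gives the distance if the first recovered part is a bridge part, and
    [gg_upper_half] if it is an upper half. *)
Lemma gg_lead n (t x : part n) s : mem_P t || mem_S t -> mem_P x || mem_S x ->
  gg t x -> bridged (Some t) (x :: s) ->
  key (lead (x :: s)) + key_base n <= key t.
Proof.
move=> tPS xPS tx /= /andP[+ _]; rewrite /bridge_ok /crosses.
case: ifP => /= [_ /andP[_] | _ _]; first by rewrite key_shift; key_lia.
case px: (primary_part x).
  by rewrite upper_half_id //; rewrite gg_primary ?px ?orbT in tx.
by apply: gg_upper_half => //; move: xPS; rewrite /mem_P px.
Qed.

(** * The backward run *)

(* Moves the secondary part [x] back to the right through the primary parts
   [s], and splits it once its lower half exceeds the next part. *)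
Fixpoint unmerge n (x : part n) (s : seq (part n)) : seq (part n) :=
  if s is w :: s' then
    if key (lower_half x) <= key w then shift w 1 :: unmerge (shift x (-1)) s'
    else upper_half x :: lower_half x :: s
  else [:: upper_half x; lower_half x].

Fixpoint unfold_parts n (s : seq (part n)) : seq (part n) :=
  if s is x :: s' then
    if secondary_part x then unmerge x (unfold_parts s') else x :: unfold_parts s'
  else [::].

(* Consecutive primary parts passed by [x] are at least one apart, hence do not
   get merged when the machine runs forwards. *)
Fixpoint spaced n (x : part n) (s : seq (part n)) : bool :=
  if s is w :: s' then
    (key (lower_half x) <= key w) ==>
    (if s' is w' :: _ then
       (key (lower_half (shift x (-1))) <= key w') ==> (key w' + key_base n <= key w)
     else true) && spaced (shift x (-1)) s'
  else true.

Lemma key_lower_pred n (x : part n) : secondary_part x ->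
  key (lower_half (shift x (-1))) = key (upper_half x) - key_base n.
Proof.
move=> sx; have sx' : secondary_part (shift x (-1)) by [].
have := upper_halfS sx'; rewrite shiftD addNr shift0 => ->.
by rewrite key_shift; key_lia.
Qed.

Lemma key_upper_pred n (x : part n) : secondary_part x ->
  upper_half (shift x (-1)) = lower_half x.
Proof.
move=> sx; have sx' : secondary_part (shift x (-1)) by [].
by rewrite -(lower_halfS sx') shiftD addNr shift0.
Qed.

Lemma head_unmerge n d (x : part n) s :
  head d (unmerge x s) =
  if (if s is w :: _ then key (lower_half x) <= key w else false)
  then shift (head d s) 1 else upper_half x.
Proof. by case: s => //= w s; case: ifP. Qed.

(** The hypothesis on halves prevents [z] from passing both halves of [x]. For neighbours it is
    [gg_not_interleaved], and it persists while both move to the right. *)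
Lemma spaced_unmerge n (z x : part n) s : secondary_part z -> secondary_part x ->
  (key (lower_half z) <= key (upper_half x) ->
   ~~ (key (upper_half z) <= key (lower_half x) + key_base n)) ->
  spaced x s -> spaced z (unmerge x s).
Proof.
elim: s z x => [|w s IH] z x sz sx.
  move=> K _ /=; apply/implyP => /K.
  rewrite key_lower_pred // => h.
  by have -> : (key (upper_half z) - key_base n <= key (lower_half x)) = false by key_lia.
move=> K /=; case: ifP => /= xw; last first.
  move=> _; apply/implyP => /K.
  rewrite key_lower_pred // => h.
  by have -> : (key (upper_half z) - key_base n <= key (lower_half x)) = false by key_lia.
move=> /andP[ws sp]; apply/implyP => zw.
have sz' : secondary_part (shift z (-1)) by [].
have sx' : secondary_part (shift x (-1)) by [].
apply/andP; split; last first.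
  (* As a shift by one exchanges the halves, the hypothesis for the two shifted parts is the
     contrapositive of [K]. *)
  apply: IH => //; rewrite !key_lower_pred // !key_upper_pred // => h1.
  by apply/negP => h2; have := K ltac:(key_lia); key_lia.
case: s ws {IH sp} => [_|v s] /=; rewrite ?key_upper_pred ?key_shift //.
  by apply/implyP => _; key_lia.
case: ifP => /= h; rewrite ?key_shift ?key_upper_pred //; first by key_lia.
by move=> _; apply/implyP => _; key_lia.
Qed.

Lemma unmerge_sorted n (x : part n) s : mem_S x -> all (@mem_P n) s ->
  sorted (@succ n) s -> spaced x s ->
  (if s is w :: _ then crosses x w ==> (key w + key_base n < key x) else true) ->
  all (@mem_P n) (unmerge x s) && sorted (@succ n) (unmerge x s).
Proof.
have B0 := key_base_gt0 n.
elim: s x => [|w s IH] x xS /=.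
  have sx : secondary_part x by case/andP: xS.
  move=> _ _ _ _; rewrite !mem_P_key upper_half_primary // lower_half_primary //=.
  by rewrite succE; have := halves_lt sx; have := lower_half_gt_boundary xS; key_lia.
have sx : secondary_part x by case/andP: xS.
have hx := halves_lt sx; have lx := lower_half_gt_boundary xS.
rewrite /crosses sx /=; move=> /andP[wP sP] ws; case: ifP => xw /=; last first.
  move=> _ _; rewrite wP sP ws !mem_P_key upper_half_primary //.
  rewrite lower_half_primary //=.
  by rewrite !succE; key_lia.
move=> /andP[h sp] wx.
have x'S : mem_S (shift x (-1)) by exact: mem_S_uncross sx wP wx xw.
have s_sorted : sorted (@succ n) s by exact: path_sorted ws.
have /andP[uP us] : all (@mem_P n) (unmerge (shift x (-1)) s) &&
    sorted (@succ n) (unmerge (shift x (-1)) s).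
  (* Passing [w] costs [x] one, and by [spaced] the next part it passes lies at least one below [w],
     so the inequality carries over. *)
  apply: IH => //; case: s h {sP ws sp s_sorted} => // v s h.
  apply/implyP => /andP[_ h1]; rewrite h1 /= in h; rewrite key_shift; key_lia.
rewrite uP /= mem_P_key key_shift primary_shift; apply/andP; split.
  by move: wP; rewrite mem_P_key => /andP[-> /=]; key_lia.
case E : (unmerge (shift x (-1)) s) us => [//|v r] /= ->.
rewrite andbT succE key_shift.
have := head_unmerge v (shift x (-1)) s; rewrite E /= => ->.
case: s h {IH E uP sP ws sp s_sorted} => [_|y s /=].
  by rewrite key_upper_pred //; key_lia.
by case: ifP => //= _ h; rewrite ?key_shift ?key_upper_pred //; key_lia.
Qed.

(** Proved together by induction: [spaced] lets [x] move through the unfolded tail, and the value of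
    the head turns condition (2), stated with [lead], into an inequality with the first part of that
    tail. *)
Lemma unfold_parts_spec n t (s : seq (part n)) :
  all (fun x => mem_P x || mem_S x) s -> sorted (@gg n) s -> bridged t s ->
  [/\ all (@mem_P n) (unfold_parts s), sorted (@succ n) (unfold_parts s),
      head (boundary n) (unfold_parts s) = lead s &
      forall z, secondary_part z -> (if s is x :: _ then gg z x else true) ->
        spaced z (unfold_parts s)].
Proof.
have B0 := key_base_gt0 n.
elim: s t => [|x s IH] t //= /andP[xPS sPS] xs /andP[ok br].
have [uP us uh usp] := IH _ sPS (path_sorted xs) br.
case: (boolP (secondary_part x)) => sx /=.
  have xS := mem_PS_secondary xPS sx.
  have sp : spaced x (unfold_parts s).
    by apply: usp => //; case: s xs {IH uP us uh sPS ok br} => //= y s /andP[].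
  have cr : is_true (if unfold_parts s is w :: _
      then crosses x w ==> (key w + key_base n < key x) else true).
    case: (unfold_parts s) uh => //= w _ ->; apply/implyP => xl.
    by move/implyP: ok => /(_ xl) /andP[].
  have /andP[vP vs] := unmerge_sorted xS uP us sp cr.
  split=> //.
    rewrite head_unmerge uh; case: (unfold_parts s) uh => [<-|w r /= -> //] /=.
    by have := lower_half_gt_boundary xS; rewrite ltNge => /negPf ->.
  move=> z sz zx; apply: spaced_unmerge => //; exact: gg_not_interleaved.
have px : primary_part x by rewrite secondaryN negbK in sx.
have xP : mem_P x by move: xPS; rewrite /mem_S (negPf sx) orbF.
have lx : key (lead s) + key_base n <= key x \/ s = [::].
  case: s xs sPS br {IH uP us uh usp ok} => [|y s]; [by right|left].
  by apply: gg_lead => //; [case/andP: sPS | case/andP: xs].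
split=> //.
- by rewrite xP.
- case E: (unfold_parts s) us uh => [//|w r] /= -> wl; rewrite andbT succE wl.
  by case: lx => [|s0]; [key_lia | rewrite s0 in E].
- by rewrite upper_half_id.
move=> z sz zx; apply/implyP => _.
have zx' : key x + key_base n < key z.
  have := key_shift_neq 1 px sz.
  by move: zx; rewrite gg_primary ?px ?orbT // key_shift mul1r; key_lia.
apply/andP; split.
  case E: (unfold_parts s) uh => [//|w r] /= ->; apply/implyP => _.
  by case: lx => // s0; rewrite s0 in E.
(* Passing [x] costs [z] one, and the next part lies at least one below [x], so [gg] holds again
   after the move. *)
apply: usp => //; case: s xs {IH uP us uh sPS ok br lx} => //= y s /andP[xy _].
have := xy; rewrite gg_primary ?px // => xy'.
case: (boolP (primary_part y)) => py.
  by rewrite gg_primary ?py ?orbT // key_shift; key_lia.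
have : key (shift y 1) != key x.
  by apply: key_neq; rewrite primary_shift px (negPf py).
rewrite gg_secondary // !succE !key_shift => ne; case: ifP => _; key_lia.
Qed.

(** * Running the machine *)

(* The machine never looks at two consecutive secondary parts, so nothing is
   asked of them. *)
Definition settled n (x y : part n) : bool :=
  secondary_part x && secondary_part y || gg x y.

Lemma gg_settled n (x y : part n) : gg x y -> settled x y.
Proof. by rewrite /settled orbC => ->. Qed.

Lemma settled_step1 n (x y : part n) : settled x y ->
  [&& mem_P x, mem_P y, succ x y & ~~ gg x y] = false.
Proof.
rewrite /settled /mem_P !secondaryN.
by case: (primary_part x) => //=; case: (gg x y) => //=; rewrite !andbF.
Qed.

Lemma settled_step2 n (x y : part n) : settled x y ->
  [&& mem_P x, mem_S y & ~~ gg x y] = false.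
Proof.
rewrite /settled /mem_P /mem_S !secondaryN.
by case: (primary_part x) => //=; case: (gg x y) => //=; rewrite !andbF.
Qed.

Lemma step1_skip n (x y : part n) s : settled x y ->
  step1 (x :: y :: s) = omap (cons x) (step1 (y :: s)).
Proof. by move=> /settled_step1 xy /=; rewrite xy. Qed.

Lemma step2_skip n (x y : part n) s : settled x y ->
  step2 (x :: y :: s) = omap (cons x) (step2 (y :: s)).
Proof. by move=> /settled_step2 xy /=; rewrite xy. Qed.

(** The machine takes the leftmost pair, so a settled prefix is skipped. The pair at the junction
    has to be settled too, whence [rcons s v]. *)
Lemma step1_cat n (s s' : seq (part n)) v : sorted (@settled n) (rcons s v) ->
  step1 (s ++ v :: s') = omap (cat s) (step1 (v :: s')).
Proof.
elim: s => [|x s IH] sv; first by rewrite cat0s; case: (step1 _).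
have IHs := IH (path_sorted sv).
case: s sv {IH} IHs => [|y s] /andP[xy _] IHs.
  exact: step1_skip.
by rewrite [LHS](step1_skip _ xy) [step1 _]IHs; case: (step1 _).
Qed.

Lemma step2_cat n (s s' : seq (part n)) v : sorted (@settled n) (rcons s v) ->
  step2 (s ++ v :: s') = omap (cat s) (step2 (v :: s')).
Proof.
elim: s => [|x s IH] sv; first by rewrite cat0s; case: (step2 _).
have IHs := IH (path_sorted sv).
case: s sv {IH} IHs => [|y s] /andP[xy _] IHs.
  exact: step2_skip.
by rewrite [LHS](step2_skip _ xy) [step2 _]IHs; case: (step2 _).
Qed.

Lemma step1_settled n (s : seq (part n)) : sorted (@settled n) s -> step1 s = None.
Proof.
elim: s => // x [|y s] IH // /andP[xy ys].
by rewrite step1_skip // IH.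
Qed.

Lemma step2_primary n (s : seq (part n)) : all (@mem_P n) s -> step2 s = None.
Proof.
elim: s => // x [|y s] IH // /andP[_ sP].
have /andP[/andP[py _] _] := sP.
by rewrite /= /mem_S secondaryN py /= andbF; rewrite -/(step2 (y :: s)) IH.
Qed.

Lemma step1_merge n (s s' : seq (part n)) x : mem_S x ->
  sorted (@settled n) (rcons s (upper_half x)) ->
  step1 (s ++ upper_half x :: lower_half x :: s') = Some (s ++ x :: s').
Proof.
move=> xS sx; have /andP[x_s x2] := xS.
have lx := lower_half_gt_boundary xS; have ul := halves_lt x_s.
rewrite step1_cat //= !mem_P_key upper_half_primary // lower_half_primary //.
rewrite gg_primary ?upper_half_primary // succE.
have [-> ->] := mul_color_halves x_s.
have -> : key (boundary n) < key (upper_half x) by key_lia.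
have -> : key (lower_half x) < key (upper_half x) by key_lia.
have -> : (key (lower_half x) + key_base n <= key (upper_half x)) = false by key_lia.
by rewrite lx /=; case: x {xS sx x_s x2 lx ul}.
Qed.

Lemma step2_pass n (s s' : seq (part n)) x w : mem_S x -> mem_P w ->
  sorted (@settled n) (rcons s w) -> ~~ gg w x ->
  step2 (s ++ w :: x :: s') = Some (s ++ shift x 1 :: shift w (-1) :: s').
Proof. by move=> xS wP sw Nwx; rewrite step2_cat //= xS wP Nwx. Qed.

(** Step 1 merges the halves again, and each crossing of Step 2 undoes one backward move. The parts
    that were passed join the prefix [A], where [spaced] keeps them settled. *)
Lemma at_step1_unmerge n (s A : seq (part n)) x nu : mem_S x ->
  all (@mem_P n) s -> spaced x s ->
  (if s is w :: _ then crosses x w ==> (key w + key_base n < key x) else true) ->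
  sorted (@settled n) (rcons A (head (boundary n) (unmerge x s))) ->
  at_step2 (A ++ x :: s) nu -> at_step1 (A ++ unmerge x s) nu.
Proof.
have B0 := key_base_gt0 n.
elim: s A x => [|w s IH] A x xS /=.
  move=> _ _ _ Ax; apply: Step1_merge; exact: step1_merge.
have sx : secondary_part x by case/andP: xS.
have hx := halves_lt sx.
rewrite /crosses sx /= => /andP[wP sP]; case: ifP => /= xw.
  move=> /andP[ws sp] wx Aw nu_s.
  have x'S : mem_S (shift x (-1)) by exact: mem_S_uncross sx wP wx xw.
  have sx' : secondary_part (shift x (-1)) by [].
  have w1P : mem_P (shift w 1).
    by move: wP; rewrite !mem_P_key key_shift primary_shift => /andP[-> ?] /=; key_lia.
  rewrite -cat_rcons; apply: IH => //.
  - case: s ws {sP sp nu_s} => // v s /implyP ws; rewrite /crosses sx' /=.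
    by apply/implyP => /ws; rewrite key_shift; key_lia.
  - have : gg (shift w 1) (head (boundary n) (unmerge (shift x (-1)) s)).
      rewrite gg_primary; last by case/andP: w1P => ->.
      rewrite head_unmerge key_shift; case: s ws {sP sp nu_s} => [_|v s /= ws].
        by rewrite key_upper_pred //; key_lia.
      by case: ifP ws => /= h; rewrite ?key_shift ?key_upper_pred //; key_lia.
    move=> /gg_settled; case: A Aw {nu_s} => [|a A] /=; first by move=> _ ->.
    by rewrite !rcons_path last_rcons => /andP[-> ->].
  (* The crossing turns [(w + 1, x - 1)] back into [(x, w)]. It takes place because [w + 1] lies
     below [x]. *)
  - rewrite cat_rcons; apply: Step2_cross nu_s.
    rewrite step2_pass // ?shiftD ?addNr ?subrr ?shift0 //.
    rewrite gg_primary; last by case/andP: w1P => ->.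
    by rewrite !key_shift; key_lia.
move=> _ _ Ax; apply: Step1_merge; exact: step1_merge.
Qed.

Lemma step2_secondary n (x : part n) s : secondary_part x -> all (@mem_P n) s ->
  step2 (x :: s) = None.
Proof.
move=> sx sP; have := step2_primary sP; case: s {sP} => //= y s ->.
by rewrite /mem_P; move: sx; rewrite secondaryN => /negPf ->.
Qed.

Lemma sorted_rcons_cat T (e : rel T) (s s' : seq T) x :
  sorted e (rcons s x ++ s') = sorted e (rcons s x) && path e x s'.
Proof. by case: s => //= y s; rewrite cat_path last_rcons. Qed.

(** The machine rebuilds [nu] from left to right: [A] is already in final form, and what follows it
    is still entirely primary. *)
Lemma at_step1_unfold n (A s nu : seq (part n)) : nu = A ++ s ->
  mem_E nu -> bridged None nu -> at_step1 (A ++ unfold_parts s) nu.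
Proof.
move=> + /andP[nuPS nu_gg] br; elim: s A => [|x s IH] A nuE.
  rewrite -nuE; constructor; apply: step1_settled.
  by apply: sub_sorted nu_gg => y z; apply: gg_settled.
have := IH (rcons A x); rewrite !cat_rcons => /(_ nuE) /=.
case: ifP => // sx nu_s.
have := nuPS; rewrite nuE all_cat => /andP[APS xsPS].
have := br; rewrite nuE => /bridged_cat brx.
have xs_gg : sorted (@gg n) (x :: s) by move: nu_gg; rewrite nuE => /cat_sorted2[].
have /andP[xPS sPS] := xsPS; have /andP[ok brs] := brx.
have xS := mem_PS_secondary xPS sx.
have [xsP _ head_xs _] := unfold_parts_spec xsPS xs_gg brx.
have [sP us uh usp] := unfold_parts_spec sPS (path_sorted xs_gg) brs.
rewrite [unfold_parts _]/= sx in head_xs.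
apply: at_step1_unmerge => //.
- apply: usp => //; move: xs_gg; clear.
  by case: s => //= y s /andP[].
- case: (unfold_parts s) uh => //= w _ ->; apply/implyP => xl.
  by move/implyP: ok => /(_ xl) /andP[].
(* The unfolded suffix begins with [lead (x :: s)], which [gg_lead] keeps settled with the last part
   of [A]. *)
- rewrite head_xs; case/lastP: A APS {IH br nu_s ok} nuE brx => // A t.
  rewrite all_rcons => /andP[tPS _] nuE; rewrite map_rcons last_rcons => brx.
  move: nu_gg; rewrite nuE sorted_rcons_cat => /and3P[At tx _].
  have tl : gg t (lead (x :: s)).
    rewrite gg_primary ?lead_primary ?orbT //.
    exact: gg_lead brx.
  rewrite -cats1 sorted_rcons_cat; apply/andP; split.
    by apply: sub_sorted At => y z; apply: gg_settled.
  by apply/andP; split=> //; apply: gg_settled.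
- apply: Step2_done; last by rewrite -nuE.
  rewrite step2_cat; first by rewrite step2_secondary.
  move: nu_gg; rewrite nuE -cat_rcons => /cat_sorted2[+ _].
  by apply: sub_sorted => y z; apply: gg_settled.
Qed.

(** The invariant at Step 1: a settled prefix [A] and a primary remainder [V]. With [take 1 V],
    settledness is required up to the junction only, as [V] may still contain troublesome pairs. *)
Definition step1_state n (s : seq (part n)) : Prop :=
  exists A V, [/\ s = A ++ V, all (fun x => mem_P x || mem_S x) A,
    all (@mem_P n) V && sorted (@succ n) V,
    sorted (@settled n) (A ++ take 1 V) & bridged None s].

(* As long as the new secondary part [x] is moving, the sequence behaves as if
   [x] and what follows it were the single part [lead (x :: V)], which the
   moves leave unchanged. *)
Definition step2_state n (s : seq (part n)) : Prop :=
  exists A x V, [/\ s = A ++ x :: V,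
    all (fun x => mem_P x || mem_S x) A && mem_S x,
    all (@mem_P n) V && sorted (@succ n) V,
    (if V is v :: _ then gg x v && (crosses x v ==> (key v + key_base n < key x))
     else true)
    & sorted (@settled n) (rcons A (lead (x :: V))) /\
      bridged None (rcons A (lead (x :: V)))].

Lemma bridged_primary n t (s : seq (part n)) :
  all (@primary_part n) s -> bridged t s.
Proof.
elim: s t => //= x s IH t /andP[px /IH ->].
by rewrite /bridge_ok /crosses secondaryN px.
Qed.

Lemma all_mem_P_primary n (s : seq (part n)) :
  all (@mem_P n) s -> all (@primary_part n) s.
Proof. by apply: sub_all => x /andP[]. Qed.

Lemma lead_mem_P n (s : seq (part n)) :
  all (@mem_P n) s -> lead s = head (boundary n) s.
Proof. by case: s => // x s /andP[/andP[px _] _]; rewrite lead_primary_cons. Qed.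

Lemma settled_primary n (x y : part n) : primary_part y -> settled x y ->
  key y + key_base n <= key x.
Proof.
by move=> py; rewrite /settled !secondaryN py andbF /= gg_primary ?py ?orbT.
Qed.

Lemma mem_S_succ n (x : part n) : mem_S x -> mem_S (shift x 1).
Proof. by case/andP=> sx x2; rewrite /mem_S [secondary_part _]sx /=; key_lia. Qed.

Lemma step2_stateP n (s : seq (part n)) : step2_state s ->
  if step2 s is Some s' then step2_state s' else step1_state s.
Proof.
have B0 := key_base_gt0 n.
move=> [A [x [V [-> /andP[APS xS] /andP[VP Vs] xV [Ag br]]]]].
have sx : secondary_part x by case/andP: xS.
have lx := halves_lt sx.
have g_up := lead_ge_upper V sx; have g_tl := lead_gt_tail V sx.
have gp := lead_primary (x :: V).
(* The end of Step 2: the invariant has kept [lead (x :: V)] settled with the left neighbour, and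
   this gives the second half of condition (2) at [x]. *)
have stop : sorted (@settled n) (rcons A x) ->
    step2 (A ++ x :: V) = None /\ step1_state (A ++ x :: V).
  move=> Ax; split; first by rewrite step2_cat // step2_secondary.
  exists (rcons A x), V; split.
  - by rewrite cat_rcons.
  - by rewrite all_rcons xS orbT.
  - by rewrite VP.
  - case: V xV {Vs VP Ag br g_up g_tl gp} => [|v V] /=; first by rewrite cats0.
    by rewrite take0 sorted_rcons_cat Ax /= => /andP[/gg_settled ->].
  - rewrite -cats1 in br; apply: bridged_replace br _.
      exact: lead_primary_cons.
    rewrite /= bridged_primary ?all_mem_P_primary // andbT.
    apply/implyP => xl; have -> : key (lead V) + key_base n < key x.
      by move: xl xV; rewrite lead_mem_P //; case: (V) => [|v r] /=;
         [rewrite /crosses leNgt lower_half_gt_boundary // andbF |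
          move=> -> /andP[]].
    case/lastP: A Ag {APS Ax} => // A y; rewrite map_rcons last_rcons.
    rewrite -cats1 sorted_rcons_cat => /and3P[_ /(settled_primary gp) + _].
    by move: (xl) => /=; rewrite /crosses => ->; rewrite key_shift mulr2n; key_lia.
case/lastP: A APS Ag br stop => [|A y] APS Ag br stop.
  by have [//|-> ?] := stop.
have := Ag; rewrite -{1}cats1 sorted_rcons_cat /= => /and3P[Ay yg _].
case: (boolP (settled y x)) => yx.
  by have [|-> ?] := stop; rewrite // -cats1 sorted_rcons_cat Ay /= yx.
move: yx; rewrite /settled sx andbT secondaryN => /norP[]; rewrite negbK => py Nyx.
have yg' := settled_primary gp yg.
have yP : mem_P y.
  by move: APS; rewrite all_rcons /mem_S secondaryN py orbF => /andP[].
rewrite cat_rcons step2_pass //.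
have y_ge : key (upper_half x) <= key y - key_base n.
  by key_lia.
exists A, (shift x 1), (shift y (-1) :: V).
(* The lower half of [x + 1] is the upper half of [x], which does not exceed [y - 1]. So the crossed
   pair leads to [y], the part that stood in this place before. *)
have -> : lead [:: shift x 1, shift y (-1) & V] = y.
  rewrite /= [secondary_part (shift x 1)]sx lower_halfS // secondaryN.
  rewrite primary_shift py /=.
  rewrite (upper_half_id (x := shift y (-1)) py) key_shift mulN1r y_ge.
  by rewrite shiftD addNr shift0.
have y_gt : key (boundary n) < key y - key_base n.
  by have := lower_half_gt_boundary xS; key_lia.
have key_yx : key y < key x + key_base n.
  by move: Nyx; rewrite gg_primary ?py // -ltNge.
split=> //.
- by rewrite mem_S_succ // andbT; move: APS; rewrite all_rcons => /andP[].
- rewrite /= mem_P_key primary_shift py VP key_shift mulN1r y_gt /=.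
  move: g_tl yg'; rewrite (lead_mem_P VP); move: (lead _) => g.
  case: (V) Vs => //= v r -> vg gy; rewrite andbT succE key_shift mulN1r.
  by key_lia.
- rewrite gg_primary ?primary_shift ?py ?orbT // !key_shift mulN1r mul1r.
  rewrite /crosses.
  by apply/andP; split; [key_lia | apply/implyP => _; key_lia].
split=> //; rewrite -!cats1 -catA in br *; apply: bridged_replace br _.
  exact: etrans (lead_primary_cons _ py) (esym (lead_primary_cons _ py)).
by apply: bridged_primary; rewrite /= py.
Qed.

Lemma step1_descending n (V s : seq (part n)) :
  all (@mem_P n) V -> sorted (@succ n) V ->
  step1 V = Some s -> exists V1 x V2,
    [/\ V = V1 ++ upper_half x :: lower_half x :: V2, s = V1 ++ x :: V2, mem_S x &
        sorted (@settled n) (rcons V1 (upper_half x))].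
Proof.
elim: V s => // y [|z V] IH s // /andP[yP zP] /andP[yz zV].
have zP' : mem_P z by case/andP: zP.
case: (boolP (settled y z)) => ys.
  rewrite step1_skip //; case E: (step1 (z :: V)) => [r|] //= [<-].
  have [V1 [x [V2 [e -> xS V1s]]]] := IH _ zP zV E.
  exists (y :: V1), x, V2; rewrite e; split=> //.
  by case: V1 e V1s => [|v V1] /= [<- _] => [_|->]; rewrite ys.
have Nyz : ~~ gg y z by apply: contra ys; exact: gg_settled.
have [x [xS xu xl]] := merge_halves yP zP' yz Nyz.
rewrite /= yP zP' yz Nyz /=; case: mul_color => //= c [cx] [<-].
by exists [::], x, V; rewrite xu xl cx.
Qed.

Lemma step1_stateP n (s s' : seq (part n)) : step1_state s -> step1 s = Some s' ->
  step2_state s'.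
Proof.
move=> [A [V [-> APS /andP[VP Vs] AV br]]].
case: V VP Vs AV br => [|v V] VP Vs AV br.
  by rewrite cats0 in AV *; rewrite step1_settled.
rewrite /= take0 cats1 in AV; rewrite step1_cat //.
case E: (step1 (v :: V)) => [r|] //= [<-].
have [V1 [x [V2 [e -> xS V1x]]]] := step1_descending VP Vs E.
have sx : secondary_part x by case/andP: xS.
have /and4P[V1P _ lP V2P] : [&& all (@mem_P n) V1, mem_P (upper_half x),
    mem_P (lower_half x) & all (@mem_P n) V2].
  by move: VP; rewrite e all_cat.
have lV2 : sorted (@succ n) (lower_half x :: V2).
  by move: Vs; rewrite e => /cat_sorted2[_ /path_sorted].
have lead_lt : key (lead V2) < key (lower_half x).
  rewrite lead_mem_P //; case: (V2) lV2 => [_|w V3 /andP[]].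
    exact: lower_half_gt_boundary.
  by rewrite succE.
(* A freshly merged part does not cross back, so it leads to the part that stood in its place. *)
have leadx : lead (x :: V2) = upper_half x by rewrite /= sx leNgt lead_lt.
exists (A ++ V1), x, V2; rewrite catA leadx; split=> //.
- rewrite all_cat APS xS andbT; apply: sub_all V1P => y -> //.
- by rewrite V2P (path_sorted lV2).
- case: (V2) V2P lead_lt => //= w V3 /andP[wP _].
  have [pw _] := andP wP; rewrite secondaryN pw /= upper_half_id // => wl.
  by rewrite gg_next_primary // /crosses leNgt wl andbF.
split.
  move: AV V1x; rewrite rcons_cat; case: V1 e {E V1P} => [|w V1] [<- _] /=.
    by rewrite cats1.
  by rewrite -cat_rcons sorted_rcons_cat => -> ->.
rewrite -cats1 -catA; rewrite e catA in br.
rewrite catA; apply: bridged_replace br _.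
  by rewrite !lead_primary_cons // upper_half_primary.
by apply: bridged_primary; rewrite /= upper_half_primary.
Qed.

Scheme at_step1_mut := Minimality for at_step1 Sort Prop
  with at_step2_mut := Minimality for at_step2 Sort Prop.

Lemma Phi_bridged n (lambda nu : seq (part n)) :
  mem_O lambda -> Phi_output lambda nu -> bridged None nu.
Proof.
move=> /andP[lP ls] out.
have : step1_state lambda.
  exists [::], lambda; split=> //; first by rewrite lP.
    by case: (lambda) => //= x s; rewrite take0.
  by apply/bridged_primary/all_mem_P_primary.
move: lambda nu out {lP ls}.
apply: (@at_step1_mut n (fun s t => step1_state s -> bridged None t)
                        (fun s t => step2_state s -> bridged None t)) => s.
- by move=> _ [A [V []]].
- by move=> s' t e _ IH /step1_stateP/(_ e).
- by move=> s' t e _ IH /step2_stateP; rewrite e.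
- by move=> t e _ IH /step2_stateP; rewrite e.
Qed.

Lemma bridged_Phi n (nu : seq (part n)) :
  mem_E nu -> bridged None nu -> mem_Phi_O nu.
Proof.
move=> nuE br; have /andP[nuPS nu_gg] := nuE.
have [uP us _ _] := unfold_parts_spec nuPS nu_gg br.
exists (unfold_parts nu); first by rewrite /mem_O uP us.
exact: (@at_step1_unfold _ [::]).
Qed.

(** * Bridges *)

Lemma slots_cat n (s t : seq (part n)) : slots (s ++ t) = slots s ++ slots t.
Proof. by rewrite /slots map_cat flatten_cat. Qed.

Lemma xlen_cat n (s t : seq (part n)) : xlen (s ++ t) = (xlen s + xlen t)%N.
Proof. by rewrite /xlen slots_cat size_cat. Qed.

(** Common to [slots], [xpart] and [orig]; it reduces the notions at a position of [nu] to position
    0 of a suffix. *)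
Lemma nth_flatten_cat n T (x0 : T) (f : part n -> seq T) s t k :
  (forall x, size (f x) = (secondary_part x).+1) ->
  nth x0 (flatten (map f (s ++ t))) (xlen s + k) = nth x0 (flatten (map f t)) k.
Proof.
move=> f_size; rewrite map_cat flatten_cat nth_cat.
have -> : size (flatten (map f s)) = xlen s.
  rewrite /xlen /slots; elim: s => //= x s IH.
  by rewrite !size_cat IH f_size; case: ifP.
by rewrite ltnNge leq_addr addKn.
Qed.

Lemma mem_I_cat n (s t : seq (part n)) k : mem_I (s ++ t) (xlen s + k) = mem_I t k.
Proof. by rewrite /mem_I /slots nth_flatten_cat // => x; case: ifP. Qed.

Lemma mem_J_cat n (s t : seq (part n)) k : mem_J (s ++ t) (xlen s + k) = mem_J t k.
Proof. by rewrite /mem_J /slots nth_flatten_cat // => x; case: ifP. Qed.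

Lemma xpart_cat n (s t : seq (part n)) k : xpart (s ++ t) (xlen s + k) = xpart t k.
Proof. by rewrite /xpart nth_flatten_cat // => x; case: ifP. Qed.

Lemma orig_cat n (s t : seq (part n)) k : orig (s ++ t) (xlen s + k) = orig t k.
Proof. by rewrite /orig nth_flatten_cat // => x; case: ifP. Qed.

Lemma index_iota_addl a i u :
  index_iota (a + i) (a + u) = [seq (a + k)%N | k <- index_iota i u].
Proof. by rewrite /index_iota subnDl iotaDl. Qed.

Lemma bridgeable_cat n (s t : seq (part n)) i u :
  bridgeable (s ++ t) (xlen s + i) (xlen s + u) = bridgeable t i u.
Proof.
rewrite /bridgeable index_iota_addl filter_map all_map.
under eq_filter => k do rewrite /= mem_I_cat.
by apply: eq_all => k /=; rewrite -addnS !xpart_cat subnDl.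
Qed.

Lemma next_primary_cat n (s t : seq (part n)) i :
  next_primary (s ++ t) (xlen s + i) = (xlen s + next_primary t i)%N.
Proof.
rewrite /next_primary -addnS xlen_cat index_iota_addl big_map.
under eq_bigl => k do rewrite mem_J_cat.
by rewrite (big_morph (addn (xlen s)) (addn_minr _) (erefl (xlen s + xlen t)%N)).
Qed.

Lemma Br_cat n (s t : seq (part n)) i :
  Br (s ++ t) (xlen s + i) = (xlen s + Br t i)%N.
Proof.
rewrite /Br next_primary_cat bridgeable_cat; case: ifP => // _.
rewrite -addnS index_iota_addl big_map.
under eq_bigl => k do rewrite mem_I_cat bridgeable_cat.
by rewrite (big_morph (addn (xlen s)) (addn_maxr _) (erefl (xlen s + i)%N)).
Qed.

Lemma bridge_part_cat n (s t : seq (part n)) i :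
  bridge_part (s ++ t) (xlen s + i) = bridge_part t i.
Proof. by rewrite /bridge_part Br_cat xpart_cat subnDl. Qed.

Lemma xlen_secondary n (x : part n) : secondary_part x -> xlen [:: x] = 2%N.
Proof. by rewrite /xlen /slots /= => ->. Qed.

(** Only the test at position 0 is new, and there [(u + 2) / 2 - 1] is the [u / 2] of the suffix. *)
Lemma bridgeable_cons n (x : part n) s u : secondary_part x ->
  bridgeable (x :: s) 0 u.+2 =
  (key (lower_half x) <= key (xpart s u) + u./2%:Z * key_base n) && bridgeable s 0 u.
Proof.
move=> sx; have x2 := xlen_secondary sx.
have -> : bridgeable s 0 u = bridgeable (x :: s) 2 u.+2.
  by rewrite -[x :: s]/([:: x] ++ s) -(bridgeable_cat [:: x]) x2.
rewrite /bridgeable /index_iota subn0 subn2 /= /mem_I /slots /= sx /=.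
congr (_ && _); rewrite succE -leNgt key_shift /xpart /= sx /=.
by rewrite -addn1 PoszD addrK.
Qed.

(** Matches the recursive [lead] with the maximum in [Br]: [r] counts the secondary parts before the
    last bridgeable position. The bound by [lead s] at every bridgeable position closes the
    induction: if the lower half of a new part exceeds [lead s], no later position is bridgeable
    from it. *)
Lemma lead_bridgeable n (s : seq (part n)) : exists r,
  [/\ (r <= find (@primary_part n) s)%N, bridgeable s 0 r.*2,
      lead s = shift (xpart s r.*2) r%:Z,
      (0 < r)%N = (if s is x :: s' then crosses x (lead s') else false) &
      forall u, (u <= find (@primary_part n) s)%N -> bridgeable s 0 u.*2 ->
        (u <= r)%N /\ key (xpart s u.*2) + u%:Z * key_base n <= key (lead s)].
Proof.
have B0 := key_base_gt0 n.
elim: s => [|x s [r [rm br er r0 r_max]]].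
  by exists 0%N; split=> // -[|u] //= _ _; rewrite mul0r addr0.
case: (boolP (primary_part x)) => px.
  exists 0%N; split=> //.
  - by rewrite lead_primary_cons // shift0 /xpart /= secondaryN px.
  - by rewrite /crosses secondaryN px.
  - move=> [|u] /=; rewrite ?px // => _ _.
    by rewrite /xpart /= secondaryN px /= upper_half_id // mul0r addr0.
have sx : secondary_part x by rewrite secondaryN.
have hx := halves_lt sx.
have up0 : xpart (x :: s) 0 = upper_half x by rewrite /xpart /= sx.
have upS u : xpart (x :: s) u.+1.*2 = xpart s u.*2.
  by rewrite doubleS -[u.*2.+2]/(2 + u.*2)%N -(xlen_secondary sx) (xpart_cat [:: x]).
have brS u : bridgeable (x :: s) 0 u.+1.*2 =
    (key (lower_half x) <= key (xpart s u.*2) + u%:Z * key_base n) &&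
    bridgeable s 0 u.*2.
  by rewrite doubleS bridgeable_cons // doubleK.
have up_le := lead_ge_upper s sx.
rewrite /crosses /= sx /= (negPf px).
case: (boolP (key (lower_half x) <= key (lead s))) => xl /=.
  exists r.+1; split=> //.
  - by rewrite brS br andbT; move: xl; rewrite er key_shift.
  - by rewrite upS er shiftD -[r.+1]addn1 PoszD.
  move=> [|u].
    by rewrite double0 up0 mul0r addr0 => _ _; move: up_le; rewrite /= sx xl.
  rewrite ltnS brS upS => um /andP[_ /(r_max _ um)[ur h]]; split=> //.
  by rewrite key_shift -[u.+1]addn1 PoszD mulrDl addrA lerD2r.
exists 0%N; split=> //; first by rewrite double0 up0 shift0.
move=> [|u]; first by rewrite double0 up0 mul0r addr0.
rewrite ltnS brS upS => um /andP[h /(r_max _ um)[_ h']].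
by move: xl; rewrite (le_trans h h').
Qed.

Lemma slots_secondary n (s : seq (part n)) k :
  (k < (find (@primary_part n) s).*2)%N ->
  nth Lower (slots s) k = if odd k then Lower else Upper.
Proof.
elim: s k => // x s IH k /=; case: ifP => // px.
rewrite /slots /= secondaryN px /= -/(slots s).
by case: k => [|[|k]] //=; rewrite doubleS !ltnS negbK => /IH.
Qed.

Lemma find_primary_slot n (s : seq (part n)) (k := (find (@primary_part n) s).*2) :
  (k <= xlen s)%N /\ ((k < xlen s)%N -> mem_J s k).
Proof.
rewrite {}/k; elim: s => // x s [IH1 IH2] /=; case: ifP => px.
  by rewrite /mem_J /slots /= secondaryN px.
have sx : secondary_part x by rewrite secondaryN px.
rewrite -[x :: s]/([:: x] ++ s) xlen_cat xlen_secondary // doubleS.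
split=> // h; rewrite -[_.+2]/(2 + _)%N -(xlen_secondary sx) mem_J_cat.
exact: IH2.
Qed.

Lemma bigminn_leq_seq (r : seq nat) (P : pred nat) a k : k \in r -> P k ->
  (\big[minn/a]_(i <- r | P i) i <= k)%N.
Proof.
elim: r => // i r IH; rewrite inE big_cons => /orP[/eqP <- ->|kr Pk].
  exact: geq_minl.
have := IH kr Pk; case: ifP => // _ h; exact: leq_trans (geq_minr _ _) h.
Qed.

Lemma bigminn_leq_id (r : seq nat) (P : pred nat) a :
  (\big[minn/a]_(i <- r | P i) i <= a)%N.
Proof.
elim: r => [|i r IH]; rewrite ?big_nil // big_cons.
by case: ifP => // _; exact: leq_trans (geq_minr _ _) IH.
Qed.

(** The search starts at position 1, so the first part has to be secondary. *)
Lemma next_primary0 n (s : seq (part n)) (k := (find (@primary_part n) s).*2) :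
  (0 < k)%N -> next_primary s 0 = k.
Proof.
move=> k0; have [k_le Jk] := find_primary_slot s; rewrite -/k in k_le Jk.
apply/eqP; rewrite eqn_leq; apply/andP; split.
  move: k_le; rewrite leq_eqVlt => /orP[/eqP ->|k_lt]; first exact: bigminn_leq_id.
  by apply: bigminn_leq_seq; [rewrite mem_index_iota k0 | exact: Jk].
rewrite /next_primary; apply: (big_ind (fun i => k <= i)%N) => // [i j ki kj|i Ji].
  by rewrite leq_min ki.
rewrite leqNgt; apply/negP => ik; move: Ji; rewrite /mem_J slots_secondary //.
by case: odd.
Qed.

Lemma BrP n (x : part n) s : secondary_part x ->
  (0 < Br (x :: s) 0)%N = crosses x (lead s) /\
  bridge_part (x :: s) 0 = lead (x :: s).
Proof.
move=> sx; have [r [rm br er <- r_max]] := lead_bridgeable (x :: s).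
have m0 : (0 < find (@primary_part n) (x :: s))%N.
  by rewrite /=; move: sx; rewrite secondaryN => /negPf ->.
suff Br_r : Br (x :: s) 0 = r.*2.
  by rewrite /bridge_part Br_r subn0 doubleK -er double_gt0.
rewrite /Br next_primary0 ?double_gt0 //; move: m0 rm r_max.
move: (find _ _) (@slots_secondary n (x :: s)) => m slot m0 rm r_max.
(* If the next primary position, or the end, is bridgeable, then it is [r.*2]. Otherwise [r < m],
   and [r.*2] is the maximum over upper halves, which occupy the even positions. *)
case: ifP => [/(r_max _ (leqnn m))[mr _]|Nbr].
  by congr (_.*2); apply/eqP; rewrite eqn_leq mr rm.
apply/eqP; rewrite eqn_leq; apply/andP; split.
  apply/bigmax_leqP_seq => i; rewrite mem_index_iota => /andP[_ im] /andP[Ii].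
  have := slot _ im; move: Ii; rewrite /mem_I => + e; rewrite e.
  case: (boolP (odd i)) => // i_even _.
  rewrite -[i]odd_double_half (negPf i_even) add0n leq_double.
  by move=> /r_max[] //; lia.
case: (posnP r) => [-> //|r0].
have r_lt : (r < m)%N.
  by rewrite ltn_neqAle rm andbT; apply: contraFneq Nbr => <-.
apply: (leq_bigmax_seq (F := id)); rewrite ?mem_index_iota ?double_gt0.
  by rewrite r0 ltn_double.
by rewrite br andbT /mem_I slot ?ltn_double // odd_double.
Qed.

(** * From positions to splittings of [nu] *)

Lemma mem_I_split n (s : seq (part n)) i : mem_I s i ->
  exists A x B, [/\ s = A ++ x :: B, secondary_part x & i = xlen A].
Proof.
elim: s i => [|x s IH] i; first by rewrite /mem_I nth_nil.
case: (boolP (secondary_part x)) => sx; last first.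
  case: i => [|i]; first by rewrite /mem_I /slots /= (negPf sx).
  have x1 : xlen [:: x] = 1%N by rewrite /xlen /slots /= (negPf sx).
  rewrite -[x :: s]/([:: x] ++ s) -[i.+1]add1n -x1 mem_I_cat.
  move=> /IH[A [y [B [-> sy ->]]]]; exists (x :: A), y, B.
  by split=> //; rewrite -xlen_cat.
have x2 := xlen_secondary sx.
case: i => [_|[|i]]; first by exists [::], x, s.
  by rewrite /mem_I /slots /= sx.
rewrite -[x :: s]/([:: x] ++ s) -[i.+2]add2n -x2 mem_I_cat.
move=> /IH[A [y [B [-> sy ->]]]]; exists (x :: A), y, B.
by split=> //; rewrite -xlen_cat.
Qed.

Lemma mem_I0 n (s : seq (part n)) :
  mem_I s 0 = if s is x :: _ then secondary_part x else false.
Proof. by case: s => [|x s] //; rewrite /mem_I /slots /=; case: ifP. Qed.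

Lemma orig0 n (x : part n) s : orig (x :: s) 0 = x.
Proof. by rewrite /orig /=; case: ifP. Qed.

Lemma left_part_cat n (A s : seq (part n)) :
  left_part (A ++ s) (xlen A) = last None (map Some A).
Proof.
case/lastP: A => [|A t] //; rewrite map_rcons last_rcons cat_rcons -cats1 xlen_cat.
case: (boolP (secondary_part t)) => st.
  by rewrite xlen_secondary // addn2 /= -addn1 orig_cat /orig /= st.
have -> : xlen [:: t] = 1%N by rewrite /xlen /slots /= (negPf st).
by rewrite addn1 /= -[xlen A]addn0 orig_cat orig0.
Qed.

Lemma ts_bridgedP n t (s : seq (part n)) :
  (forall A x B, s = A ++ x :: B -> ts_ok (last t (map Some A)) x B) ->
  ts_bridged t s.
Proof.
elim: s t => //= x s IH t ok; rewrite (ok [::] x s) //=; apply: IH => A y B e.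
by apply: (ok (x :: A)); rewrite e.
Qed.

Lemma Br_split n (A B : seq (part n)) x : secondary_part x ->
  (xlen A < Br (A ++ x :: B) (xlen A))%N = crosses x (lead B) /\
  bridge_part (A ++ x :: B) (xlen A) = lead (x :: B).
Proof.
move=> sx; have [<- <-] := BrP B sx.
by rewrite -[xlen A]addn0 Br_cat ltn_add2l bridge_part_cat.
Qed.

Lemma orig_split n (A B : seq (part n)) x : orig (A ++ x :: B) (xlen A) = x.
Proof. by rewrite -[xlen A]addn0 orig_cat orig0. Qed.

Lemma lead_crosses n (x : part n) s : crosses x (lead s) ->
  lead (x :: s) = shift (lead s) 1.
Proof. by move=> /=; rewrite /crosses => ->. Qed.

Lemma TS_split n (A B : seq (part n)) x y : secondary_part x -> secondary_part y ->
  ~~ tri x y -> (if last None (map Some A) is Some t then tri t x else true) ->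
  TS (A ++ [:: x, y & B]) (xlen A).
Proof.
move=> sx sy Nxy tx; have x2 := xlen_secondary sx.
have xlen2 : (xlen A).+2 = (xlen (rcons A x) + 0)%N.
  by rewrite -cats1 xlen_cat x2 addn0 addn2.
have e : A ++ [:: x, y & B] = rcons A x ++ y :: B by rewrite cat_rcons.
split.
- by rewrite -[xlen A]addn0 mem_I_cat mem_I0.
- by rewrite xlen2 e mem_I_cat mem_I0.
- by rewrite orig_split xlen2 e orig_cat orig0.
- by move=> t; rewrite left_part_cat orig_split; case: last tx => // u h [<-].
Qed.

Theorem theorem5p1 (n : nat) (nu : seq (part n)) (nuE : mem_E nu) :
  [<-> mem_Phi_O nu;
       forall i : nat, mem_I nu i -> (i < Br nu i)%N ->
         (forall x, left_part nu i = Some x -> gg x (bridge_part nu i))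
         /\ ~~ succ (bridge_part nu i) (orig nu i);
       forall i : nat, TS nu i -> (i < Br nu i)%N ->
         succ (orig nu i) (bridge_part nu i)].
Proof.
tfae.
- move=> [lambda lO out] i Ii.
  have [A [x [B [e sx ->]]]] := mem_I_split Ii.
  have := Phi_bridged lO out; rewrite e => /bridged_cat /andP[/implyP ok _].
  have [-> ->] := Br_split A B sx => xl.
  have /andP[lx lt] := ok xl; rewrite lead_crosses // left_part_cat orig_split.
  split; last by rewrite -key_leNsucc key_shift mul1r ltW.
  move=> t; case: last lt => // u lt [<-].
  rewrite gg_primary ?primary_shift ?lead_primary ?orbT // key_shift mul1r.
  by move: lt; rewrite mulr2n addrA.
- move=> two i [Ii _ _ _] lt_i; have [_] := two i Ii lt_i; move: lt_i.
  have [A [x [B [e sx ->]]]] := mem_I_split Ii.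
  have [_] := Br_split A B sx; rewrite e orig_split => -> _.
  (* The inequality is strict because the bridge part is primary and [x] is secondary. *)
  rewrite -key_leNsucc succE lt_neqAle => ->; rewrite andbT; apply: key_neq.
  by rewrite lead_primary; move: sx; rewrite secondaryN => /negPf ->.
- move=> three; have /andP[nuPS nu_gg] := nuE.
  apply: bridged_Phi => //; apply: ts_bridged_bridged => //.
  apply: ts_bridgedP => A x B e; apply/implyP => /and3P[sx].
  case: B e => // y B e /andP[sy Nxy] tx; apply/implyP => xl.
  have [Br_i br_i] := Br_split A (y :: B) sx; rewrite -e in Br_i br_i.
  have := three (xlen A); rewrite Br_i br_i (lead_crosses xl) e orig_split.
  rewrite succE key_shift mul1r.
  by apply=> //; exact: TS_split.
Qed.
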